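(* Let $p$ be an odd prime. Define power series $\sum_{n\ge0}\gamma_1(n)q^n$, $\sum_{n\ge0}\gamma_2(n)q^n$, $\sum_{n\ge0}\gamma_3(n)q^n$ by \[ \sum_{n=0}^{\infty}\gamma_{1}(n)q^n=\left(q,q^2,\ldots,q^{p-1};q^{p}\right)_{\infty},\qquad \sum_{n=0}^{\infty}\gamma_2(n)q^n=\frac{\left(q,q^2,\ldots,q^{p-1};q^{p}\right)_{\infty}^{2}}{\left(q^2,q^4,\ldots,q^{2(p-1)};q^{2p}\right)_{\infty}}, \] \[ \sum_{n=0}^{\infty}\gamma_3(n)q^n=\frac{\left(q^2,q^4,\ldots,q^{2(p-1)};q^{2p}\right)_{\infty}^{2}}{\left(q,q^2,\ldots,q^{p-1};q^{p}\right)_{\infty}}, \] and let $\gamma_j'(n)$ denote the coefficient of $q^n$ in the reciprocal $\left(\sum_{n\ge0}\gamma_j(n)q^n\right)^{-1}$. Then for all $n\ge0$: (i) if $p>3$, $\gamma_{1}\!\left(pn+\frac{p^2-1}{24}\right)=(-1)^{\epsilon}\gamma_{1}^{\prime}(n)$, where $\epsilon=\frac{p+1}{6}$ if $p\equiv 5 \pmod 6$ and $\epsilon=\frac{p-1}{6}$ if $p\equiv 1\pmod 6$ (i.e. $\epsilon=\frac{p\pm1}{6}$ with the sign chosen so that it is an integer); (ii) $\gamma_2(pn)=\gamma^{\prime}_{2}(n)$; (iii) $\gamma_3\!\left(pn+\frac{p^2-1}{8}\right)=\gamma^{\prime}_{3}(n)$.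
   Context: $q$ is a formal variable (or complex with $|q|<1$). $(a;q)_\infty=\prod_{j\ge0}(1-aq^j)$ and $(a_1,\dots,a_m;q)_\infty=(a_1;q)_\infty\cdots(a_m;q)_\infty$. All series considered have constant term $1$, so their reciprocals are power series in $q$. *)

(* Defs.v *)
From HB Require Import structures.
From mathcomp Require Import all_boot all_order all_algebra.
From mathcomp Require Import boolp.

Set Implicit Arguments.
Unset Strict Implicit.
Unset Printing Implicit Defensive.

Import GRing.Theory.
Local Open Scope ring_scope.

(** * The ring [fps R] of formal power series in one variable over R

    A series is given by its coefficients.  The record wrapper keeps the Cauchy
    product apart from MathComp's pointwise product on functions. *)

Record fps (R : Type) := Fps { fcoef : nat -> R }.

Lemma fpsP (R : Type) (f g : fps R) :
  (forall n, fcoef f n = fcoef g n) -> f = g.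
Proof. by case: f => f; case: g => g /= /funext ->. Qed.

HB.instance Definition _ (R : Type) := gen_eqMixin (fps R).
HB.instance Definition _ (R : Type) := gen_choiceMixin (fps R).

Definition fps_zero (R : zmodType) : fps R := Fps (fun=> 0).
Definition fps_opp (R : zmodType) (f : fps R) : fps R :=
  Fps (fun n => - fcoef f n).
Definition fps_add (R : zmodType) (f g : fps R) : fps R :=
  Fps (fun n => fcoef f n + fcoef g n).

Lemma fps_addA (R : zmodType) : associative (@fps_add R).
Proof. by move=> f g h; apply: fpsP => n /=; rewrite addrA. Qed.
Lemma fps_addC (R : zmodType) : commutative (@fps_add R).
Proof. by move=> f g; apply: fpsP => n /=; rewrite addrC. Qed.
Lemma fps_add0 (R : zmodType) : left_id (@fps_zero R) (@fps_add R).
Proof. by move=> f; apply: fpsP => n /=; rewrite add0r. Qed.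
Lemma fps_addN (R : zmodType) :
  left_inverse (@fps_zero R) (@fps_opp R) (@fps_add R).
Proof. by move=> f; apply: fpsP => n /=; rewrite addNr. Qed.

HB.instance Definition _ (R : zmodType) := GRing.isZmodule.Build (fps R)
  (@fps_addA R) (@fps_addC R) (@fps_add0 R) (@fps_addN R).

Definition fps_one (R : comNzRingType) : fps R := Fps (fun n => (n == 0)%:R).
Definition fps_mul (R : comNzRingType) (f g : fps R) : fps R :=
  Fps (fun n => \sum_(i < n.+1) fcoef f i * fcoef g (n - i)).

Definition fps_trunc (R : comNzRingType) (N : nat) (f : fps R) : {poly R} :=
  \poly_(i < N) fcoef f i.

Lemma coef_fps_trunc (R : comNzRingType) N (f : fps R) n :
  (n < N)%N -> (fps_trunc N f)`_n = fcoef f n.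
Proof. by move=> ltnN; rewrite coef_poly ltnN. Qed.

Lemma fps_mul_trunc (R : comNzRingType) N (f g : fps R) n : (n < N)%N ->
  fcoef (fps_mul f g) n = (fps_trunc N f * fps_trunc N g)`_n.
Proof.
move=> ltnN; rewrite coefM; apply: eq_bigr => i _.
rewrite !coef_fps_trunc //; first exact: leq_ltn_trans (leq_subr _ _) ltnN.
by apply: leq_ltn_trans ltnN; rewrite -ltnS.
Qed.

Lemma fps_mulA (R : comNzRingType) : associative (@fps_mul R).
Proof.
move=> f g h; apply: fpsP => n.
pose T := @fps_trunc R n.+1.
transitivity ((T f * (T g * T h))`_n).
  rewrite coefM; apply: eq_bigr => i _.
  by rewrite -fps_mul_trunc ?ltnS ?leq_subr// coef_fps_trunc.
rewrite mulrA coefM; apply: eq_bigr => i _.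
by rewrite -fps_mul_trunc // coef_fps_trunc // ltnS leq_subr.
Qed.

Lemma fps_mulC (R : comNzRingType) : commutative (@fps_mul R).
Proof.
by move=> f g; apply: fpsP => n; rewrite !(@fps_mul_trunc _ n.+1) // mulrC.
Qed.

Lemma fps_mul1 (R : comNzRingType) : left_id (@fps_one R) (@fps_mul R).
Proof.
move=> f; apply: fpsP => n /=; rewrite big_ord_recl /= mul1r subn0.
by rewrite big1 ?addr0 // => i _; rewrite mul0r.
Qed.

Lemma fps_mulDl (R : comNzRingType) :
  left_distributive (@fps_mul R) (@fps_add R).
Proof.
move=> f g h; apply: fpsP => n /=; rewrite -big_split /=.
by apply: eq_bigr => i _; rewrite mulrDl.
Qed.

Lemma fps_one_neq0 (R : comNzRingType) : fps_one R != fps_zero R.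
Proof.
apply/eqP => /(congr1 (fun f => fcoef f 0)) /= /eqP.
by rewrite oner_eq0.
Qed.

HB.instance Definition _ (R : comNzRingType) :=
  GRing.Zmodule_isComNzRing.Build (fps R)
    (@fps_mulA R) (@fps_mulC R) (@fps_mul1 R) (@fps_mulDl R) (@fps_one_neq0 R).

(* Otherwise [/=] expands [fcoef (f * g) n] into a sum. *)
Arguments fcoef : simpl never.

Lemma fcoefE (R : Type) (F : nat -> R) n : fcoef (Fps F) n = F n.
Proof. by []. Qed.

Section FpsCoef.
Context {R : comNzRingType}.
Implicit Types f g h t : fps R.

Lemma fcoef0 n : fcoef (0 : fps R) n = 0. Proof. by []. Qed.
Lemma fcoef1 n : fcoef (1 : fps R) n = (n == 0)%:R. Proof. by []. Qed.
Lemma fcoefN f n : fcoef (- f) n = - fcoef f n. Proof. by []. Qed.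
Lemma fcoefD f g n : fcoef (f + g) n = fcoef f n + fcoef g n.
Proof. by []. Qed.
Lemma fcoefB f g n : fcoef (f - g) n = fcoef f n - fcoef g n.
Proof. by []. Qed.
Lemma fcoefM f g n :
  fcoef (f * g) n = \sum_(i < n.+1) fcoef f i * fcoef g (n - i).
Proof. by []. Qed.
Lemma fcoef_sum (I : Type) (r : seq I) (P : pred I) (F : I -> fps R) n :
  fcoef (\sum_(i <- r | P i) F i) n = \sum_(i <- r | P i) fcoef (F i) n.
Proof. by elim/big_rec2: _ => //= i x y _ <-. Qed.

Lemma fcoef_exp_small t k n : fcoef t 0 = 0 -> (n < k)%N ->
  fcoef (t ^+ k) n = 0.
Proof.
move=> t0; elim: k n => // k IHk n ltnk; rewrite exprS fcoefM big1 // => i _.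
case: (val i) (ltn_ord i) => [|j] ltj; first by rewrite t0 mul0r.
rewrite IHk ?mulr0 // (leq_trans _ (ltnSE ltnk)) // ltn_subrL /=.
by case: (n) ltj.
Qed.

Lemma fcoefM_small f g k n :
  (forall m, (m < k)%N -> fcoef g m = 0) -> (n < k)%N -> fcoef (f * g) n = 0.
Proof.
move=> g0 ltnk; rewrite fcoefM big1 // => i _.
by rewrite g0 ?mulr0 // (leq_ltn_trans (leq_subr _ _)).
Qed.

End FpsCoef.

Definition fps_const (R : comNzRingType) (c : R) : fps R :=
  Fps (fun n => if n is 0 then c else 0).

Lemma fcoef_constM (R : comNzRingType) (c : R) (f : fps R) n :
  fcoef (fps_const c * f) n = c * fcoef f n.
Proof.
rewrite fcoefM big_ord_recl subn0 big1 ?addr0 // => i _.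
by rewrite mul0r.
Qed.

Definition fps_unit (R : comUnitRingType) : {pred fps R} :=
  fun f => fcoef f 0 \is a GRing.unit.

(* With c the constant term of f and h := 1 - c^-1 f, the inverse of
   f = c (1 - h) is c^-1 \sum_k h^k; as h has no constant term, the terms with
   k > n do not contribute to the coefficient of degree n. *)
Definition fps_inv (R : comUnitRingType) (f : fps R) : fps R :=
  if f \in @fps_unit R then
    let c := (fcoef f 0)^-1 in
    let h := 1 - fps_const c * f in
    fps_const c * Fps (fun n => fcoef (\sum_(k < n.+1) h ^+ k) n)
  else f.

Lemma fcoef_geom_stable (R : comNzRingType) (h : fps R) n N :
  fcoef h 0 = 0 -> (n < N)%N ->
  fcoef (\sum_(k < N) h ^+ k) n = fcoef (\sum_(k < n.+1) h ^+ k) n.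
Proof.
move=> h0 ltnN; rewrite -(subnKC ltnN); elim: (N - _)%N => [|m IHm].
  by rewrite addn0.
by rewrite addnS big_ord_recr fcoefD IHm fcoef_exp_small ?addr0 ?leq_addr.
Qed.

Lemma fps_mulV (R : comUnitRingType) :
  {in @fps_unit R, left_inverse 1 (@fps_inv R) *%R}.
Proof.
move=> f fU; rewrite /fps_inv fU /=.
set c := (fcoef f 0)^-1; set h := 1 - fps_const c * f; set S := Fps _.
have h0 : fcoef h 0 = 0 by rewrite fcoefB fcoef_constM mulVr // subrr.
rewrite mulrAC mulrC; have -> : fps_const c * f = 1 - h by rewrite subKr.
apply: fpsP => n; transitivity (fcoef ((\sum_(k < n.+1) h ^+ k) * (1 - h)) n).
  rewrite !fcoefM; apply: eq_bigr => i _; congr (_ * _).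
  by rewrite fcoefE (fcoef_geom_stable h0 (ltn_ord i)).
have -> : (\sum_(k < n.+1) h ^+ k) * (1 - h) = 1 - h ^+ n.+1.
  by rewrite mulrC -opprB mulNr -subrX1 opprB.
by rewrite fcoefB fcoef_exp_small // subr0.
Qed.

Lemma fps_unitPl (R : comUnitRingType) (f g : fps R) :
  g * f = 1 -> @fps_unit R f.
Proof.
move=> /(congr1 (fun f => fcoef f 0)); rewrite fcoefM big_ord1 => gf1.
by apply/unitrPr; exists (fcoef g 0); rewrite mulrC.
Qed.

Lemma fps_inv_out (R : comUnitRingType) :
  {in [predC @fps_unit R], @fps_inv R =1 id}.
Proof. by move=> f; rewrite inE /fps_inv => /negbTE ->. Qed.

HB.instance Definition _ (R : comUnitRingType) :=
  GRing.ComNzRing_hasMulInverse.Build (fps R)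
    (@fps_mulV R) (@fps_unitPl R) (@fps_inv_out R).

Definition fps_var (R : comNzRingType) : fps R := Fps (fun n => (n == 1)%:R).

(** * The infinite q-shifted factorials *)

(* [qpoch a t] is $(a; t)_\infty = \prod_{j \ge 0} (1 - a t^j)$, for t without
   constant term: the factors with j > n are then congruent to 1 modulo
   degree n + 1 and do not change the coefficient of degree n. *)
Definition qpoch (R : comNzRingType) (a t : fps R) : fps R :=
  Fps (fun n => fcoef (\prod_(j < n.+1) (1 - a * t ^+ j)) n).

Lemma qpoch_cvg (R : comNzRingType) (a t : fps R) n N :
  fcoef t 0 = 0 -> (n < N)%N ->
  fcoef (\prod_(j < N) (1 - a * t ^+ j)) n = fcoef (qpoch a t) n.
Proof.
move=> t0 ltnN; rewrite -(subnKC ltnN); elim: (N - _)%N => [|m IHm].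
  by rewrite addn0.
rewrite addnS big_ord_recr /= mulrBr mulr1 fcoefB IHm mulrA.
rewrite (@fcoefM_small _ _ _ (n.+1 + m)) ?subr0 ?leq_addr // => k ltk.
exact: fcoef_exp_small.
Qed.

Definition qpochs (R : comNzRingType) (s : seq (fps R)) (t : fps R) : fps R :=
  \prod_(a <- s) qpoch a t.

Definition q : fps int := fps_var int.

(* $(q, q^2, \ldots, q^{p-1}; q^p)_\infty$ *)
Definition P1 (p : nat) : fps int :=
  qpochs [seq q ^+ i | i <- iota 1 p.-1] (q ^+ p).

(* $(q^2, q^4, \ldots, q^{2(p-1)}; q^{2p})_\infty$ *)
Definition P2 (p : nat) : fps int :=
  qpochs [seq q ^+ (2 * i) | i <- iota 1 p.-1] (q ^+ (2 * p)).

Definition Gamma1 (p : nat) : fps int := P1 p.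
Definition Gamma2 (p : nat) : fps int := P1 p ^+ 2 / P2 p.
Definition Gamma3 (p : nat) : fps int := P2 p ^+ 2 / P1 p.

Definition gamma1 (p n : nat) : int := fcoef (Gamma1 p) n.
Definition gamma2 (p n : nat) : int := fcoef (Gamma2 p) n.
Definition gamma3 (p n : nat) : int := fcoef (Gamma3 p) n.

Definition gamma1' (p n : nat) : int := fcoef (Gamma1 p)^-1 n.
Definition gamma2' (p n : nat) : int := fcoef (Gamma2 p)^-1 n.
Definition gamma3' (p n : nat) : int := fcoef (Gamma3 p)^-1 n.

(* The inverses above are genuine: [x^-1] is only meaningful on units. *)

Lemma qpoch_fcoef0 (R : comNzRingType) (a t : fps R) :
  fcoef a 0 = 0 -> fcoef (qpoch a t) 0 = 1.
Proof.
by move=> a0; rewrite fcoefE big_ord1 fcoefB fcoefM big_ord1 a0 mul0r subr0.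
Qed.

Lemma qpochs_fcoef0 (R : comNzRingType) (s : seq (fps R)) (t : fps R) :
  (forall a, a \in s -> fcoef a 0 = 0) -> fcoef (qpochs s t) 0 = 1.
Proof.
move=> s0; rewrite /qpochs big_seq.
elim/big_ind: _ => [//|f g f1 g1|a /s0]; last exact: qpoch_fcoef0.
by rewrite fcoefM big_ord1 f1 g1 mulr1.
Qed.

Lemma P1_unit p : P1 p \is a GRing.unit.
Proof.
change (fcoef (P1 p) 0 \is a GRing.unit); rewrite qpochs_fcoef0 ?unitr1 //.
move=> a /mapP[i]; rewrite mem_iota => /andP[i_gt0 _] ->.
exact: fcoef_exp_small.
Qed.

Lemma P2_unit p : P2 p \is a GRing.unit.
Proof.
change (fcoef (P2 p) 0 \is a GRing.unit); rewrite qpochs_fcoef0 ?unitr1 //.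
move=> a /mapP[i]; rewrite mem_iota => /andP[i_gt0 _] ->.
by apply: fcoef_exp_small; rewrite // muln_gt0.
Qed.

Lemma Gamma1_unit p : Gamma1 p \is a GRing.unit.
Proof. exact: P1_unit. Qed.

Lemma Gamma2_unit p : Gamma2 p \is a GRing.unit.
Proof. by rewrite unitrM unitrV unitrX ?P1_unit ?P2_unit. Qed.

Lemma Gamma3_unit p : Gamma3 p \is a GRing.unit.
Proof. by rewrite unitrM unitrV unitrX ?P1_unit ?P2_unit. Qed.

(* For a prime p > 3 the division by 6 is exact. *)
Definition eps (p : nat) : nat :=
  (if p %% 6 == 5 then (p + 1) %/ 6 else (p - 1) %/ 6)%N.

(* Main.v *)
(** Write f_k for the product of the 1 - q^(k i), i >= 1.  The three series are
    T(q) / T(q^p) with T = f_1, f_1^2 / f_2 and f_2^2 / f_1, which by the Jacobi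
    triple product are sums of +-q^(e(m)) over all integers m, with
    24 e(m) + 1 = (6 m - 1)^2, e(m) = m^2 and 8 e(m) + 1 = (4 m - 1)^2.
    Hence e(m) = r modulo p, for the r of the theorem, forces p to divide the
    squared number, and the corresponding part of T is +-q^r T(q^(p^2)).  So the
    terms of T(q) / T(q^p) of exponent r modulo p add up to
    +-q^r T(q^(p^2)) / T(q^p), which is +-q^r times the reciprocal of the series
    with q^p for q.  The triple product is the limit of the q-binomial theorem,
    the error terms being divisible by a large power of q. *)

Require Import Defs.
From mathcomp Require Import all_boot all_order all_algebra.
From mathcomp Require Import zify ring.

Set Implicit Arguments.
Unset Strict Implicit.
Unset Printing Implicit Defensive.

Import GRing.Theory.
Local Open Scope ring_scope.

(** * Congruence of power series modulo a power of the variable *)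

Definition eqmod (R : comNzRingType) N (f g : fps R) :=
  forall n, (n < N)%N -> fcoef f n = fcoef g n.

Section EqMod.
Context {R : comNzRingType}.
Implicit Types f g h a t x y z : fps R.

Lemma eqmod_refl N f : eqmod N f f. Proof. by []. Qed.

Lemma eqmod_sym N f g : eqmod N f g -> eqmod N g f.
Proof. by move=> fg n /fg. Qed.

Lemma eqmod_trans N g f h : eqmod N f g -> eqmod N g h -> eqmod N f h.
Proof. by move=> fg gh n ltn; rewrite fg ?gh. Qed.

Lemma eqmodW M N f g : (N <= M)%N -> eqmod M f g -> eqmod N f g.
Proof. by move=> leNM fg n ltn; apply: fg; apply: leq_trans leNM. Qed.

Lemma eqmodD N f g f' g' :
  eqmod N f g -> eqmod N f' g' -> eqmod N (f + f') (g + g').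
Proof. by move=> fg fg' n ltn; rewrite !fcoefD fg ?fg'. Qed.

Lemma eqmodM N f g f' g' :
  eqmod N f g -> eqmod N f' g' -> eqmod N (f * f') (g * g').
Proof.
move=> fg fg' n ltn; rewrite !fcoefM; apply: eq_bigr => i _.
by rewrite fg ?fg' //; have := ltn_ord i; lia.
Qed.

Lemma eqmod_sum (I : Type) (r : seq I) (P : pred I) N (F G : I -> fps R) :
  (forall i, P i -> eqmod N (F i) (G i)) ->
  eqmod N (\sum_(i <- r | P i) F i) (\sum_(i <- r | P i) G i).
Proof.
by move=> FG; elim/big_rec2: _ => // i f g /FG; apply: eqmodD.
Qed.

Lemma eqmod_prod (I : Type) (r : seq I) (P : pred I) N (F G : I -> fps R) :
  (forall i, P i -> eqmod N (F i) (G i)) ->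
  eqmod N (\prod_(i <- r | P i) F i) (\prod_(i <- r | P i) G i).
Proof.
by move=> FG; elim/big_rec2: _ => // i f g /FG; apply: eqmodM.
Qed.

Lemma eqmod_eq f g : (forall N, eqmod N f g) -> f = g.
Proof. by move=> fg; apply: fpsP => n; apply: (fg n.+1). Qed.

Lemma fcoef_sign k f n : fcoef ((-1) ^+ k * f) n = (-1) ^+ k * fcoef f n.
Proof.
by rewrite -signr_odd -[in RHS]signr_odd; case: odd; rewrite ?mulN1r ?mul1r.
Qed.

Lemma fcoefM0 f g : fcoef (f * g) 0 = fcoef f 0 * fcoef g 0.
Proof. by rewrite fcoefM big_ord1. Qed.

Lemma fcoefX0 f k : (0 < k)%N -> fcoef f 0 = 0 -> fcoef (f ^+ k) 0 = 0.
Proof. by move=> k0 f0; apply: fcoef_exp_small. Qed.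

(** * Infinite products *)

Lemma qpoch_eqmod a t n N : fcoef t 0 = 0 -> (n <= N)%N ->
  eqmod n (\prod_(j < N) (1 - a * t ^+ j)) (qpoch a t).
Proof.
by move=> t0 leN k ltk; apply: qpoch_cvg => //; apply: leq_trans leN.
Qed.

Lemma qpochN_eqmod a t n : fcoef t 0 = 0 ->
  eqmod n (\prod_(j < n) (1 + a * t ^+ j)) (qpoch (- a) t).
Proof.
move=> t0; apply: eqmod_trans _ (qpoch_eqmod _ t0 (leqnn n)).
by under [X in eqmod _ _ X]eq_bigr do rewrite mulNr opprK.
Qed.

Lemma qpoch_shift a t k : fcoef t 0 = 0 ->
  qpoch a t = \prod_(j < k) (1 - a * t ^+ j) * qpoch (a * t ^+ k) t.
Proof.
move=> t0; apply: eqmod_eq => N.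
apply: eqmod_trans (eqmod_sym (qpoch_eqmod a t0 (leq_addl k N))) _.
rewrite big_split_ord /=; apply: eqmodM => //.
apply: eqmod_trans _ (qpoch_eqmod _ t0 (leqnn N)).
by under [X in eqmod _ _ X]eq_bigr do rewrite -mulrA -exprD.
Qed.

(** Every exponent is [p * j + i] for exactly one residue [i < p]; at finite level, [N] rows of [p]
    factors make up the first [N * p] factors. *)
Lemma qpoch_split a t p : (0 < p)%N -> fcoef t 0 = 0 ->
  \prod_(i < p) qpoch (a * t ^+ i) (t ^+ p) = qpoch a t.
Proof.
move=> p0 t0; apply: eqmod_eq => N.
have tp0 : fcoef (t ^+ p) 0 = 0 by exact: fcoefX0.
apply: (eqmod_trans (g := \prod_(i < p) \prod_(j < N)
   (1 - a * t ^+ i * (t ^+ p) ^+ j))).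
  by apply: eqmod_prod => i _; apply/eqmod_sym/qpoch_eqmod.
have leN : (N <= N * p)%N by rewrite leq_pmulr.
apply: eqmod_trans _ (qpoch_eqmod a t0 leN).
rewrite exchange_big /=.
suff -> : \prod_(j < N) \prod_(i < p) (1 - a * t ^+ i * (t ^+ p) ^+ j) =
          \prod_(j < N * p) (1 - a * t ^+ j) by [].
elim: N {leN} => [|N IHN]; first by rewrite !big_ord0.
rewrite big_ord_recr /= IHN mulSn addnC big_split_ord /=; congr (_ * _).
by apply: eq_bigr => i _; rewrite -mulrA -exprM -exprD addnC mulnC.
Qed.

Lemma qpoch_sqr a t : fcoef t 0 = 0 ->
  qpoch (- a) t * qpoch a t = qpoch (a ^+ 2) (t ^+ 2).
Proof.
move=> t0; apply: eqmod_eq => N.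
have tt0 : fcoef (t ^+ 2) 0 = 0 by exact: fcoefX0.
apply: eqmod_trans _ (qpoch_eqmod _ tt0 (leqnn N)).
apply: eqmod_trans (eqmodM _ _) _.
- exact: eqmod_sym (qpoch_eqmod _ t0 (leqnn N)).
- exact: eqmod_sym (qpoch_eqmod _ t0 (leqnn N)).
rewrite -big_split /= => n _; congr (fcoef _ n); apply: eq_bigr => i _.
by rewrite exprAC; ring.
Qed.

(** * The q-binomial theorem *)

(** The Gaussian binomial coefficient in base [t], given by a Pascal recursion so that no division
    occurs. *)
Fixpoint qbin t N k : fps R :=
  match N, k with
  | _, 0 => 1
  | 0, _.+1 => 0
  | N'.+1, k'.+1 => qbin t N' k'.+1 + t ^+ (N' - k') * qbin t N' k'
  end.
Arguments qbin : simpl never.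

Definition qfact t n : fps R := \prod_(j < n) (1 - t * t ^+ j).

Lemma qbin0 t N : qbin t N 0 = 1. Proof. by case: N. Qed.

Lemma qbinS t N k :
  qbin t N.+1 k.+1 = qbin t N k.+1 + t ^+ (N - k) * qbin t N k.
Proof. by []. Qed.

Lemma qbin_small t N k : (N < k)%N -> qbin t N k = 0.
Proof.
elim: N k => [|N IHN] [|k] // ltNk; rewrite qbinS !IHN ?mulr0 ?addr0 //; lia.
Qed.

Lemma qfactS t n : qfact t n.+1 = qfact t n * (1 - t ^+ n.+1).
Proof. by rewrite /qfact big_ord_recr /= exprS. Qed.

(** The two Pascal terms contribute the factors [1 - t ^+ (N - k)] and [t ^+ (N - k) - t ^+ N.+1],
    whose sum is the new factor [1 - t ^+ N.+1]. *)
Lemma qbin_fact t N k : (k <= N)%N ->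
  qbin t N k * (qfact t k * qfact t (N - k)) = qfact t N.
Proof.
have qf0 : qfact t 0 = 1 by rewrite /qfact big_ord0.
elim: N k => [|N IHN] [|k] // leNk.
- by rewrite qbin0 qf0 !mul1r.
- by rewrite qbin0 qf0 !mul1r.
rewrite qbinS subSS mulrDl.
have IH2 := IHN k leNk.
have [-> | neNk] := eqVneq k N.
  rewrite qbin_small // mul0r add0r subnn expr0 mul1r qf0 mulr1.
  by move: (IHN N (leqnn N)); rewrite !qfactS subnn qf0 mulr1 mulrA => ->.
have {}leNk : (k < N)%N by lia.
have IH1 := IHN k.+1 leNk.
have eS : (N - k = (N - k.+1).+1)%N by lia.
have -> : qbin t N k.+1 * (qfact t k.+1 * qfact t (N - k)) =
   qfact t N * (1 - t ^+ (N - k)).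
  by rewrite -IH1 eS [qfact t (_ - _).+1]qfactS !mulrA.
have -> : t ^+ (N - k) * qbin t N k * (qfact t k.+1 * qfact t (N - k)) =
   qfact t N * (t ^+ (N - k) - t ^+ N.+1).
  have -> : t ^+ N.+1 = t ^+ (N - k) * t ^+ k.+1.
    by rewrite -exprD; congr (_ ^+ _); lia.
  by rewrite -IH2 qfactS; ring.
by rewrite qfactS; ring.
Qed.

(** Choosing [x] or [y * t ^+ N] in the last factor yields the two Pascal terms. The form
    homogeneous in [x] and [y] allows [x] to be a power of [t], which need not be invertible. *)
Lemma qbinomial x y t N :
  \prod_(j < N) (x + y * t ^+ j) =
  \sum_(k < N.+1) t ^+ 'C(k, 2) * qbin t N k * y ^+ k * x ^+ (N - k).
Proof.
elim: N => [|N IHN]; first by rewrite big_ord0 big_ord1 !mulr1.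
rewrite big_ord_recr /= IHN mulrDr [in RHS]big_ord_recl /=.
rewrite bin0n qbin0 !expr0 !mulr1 mul1r.
under [in RHS]eq_bigr => k _ do
  rewrite /bump leq0n add1n qbinS mulrDr !mulrDl subSS.
rewrite big_split /= addrA; congr (_ + _); last first.
  rewrite big_distrl /=; apply: eq_bigr => k _.
  have -> : t ^+ N = t ^+ k * t ^+ (N - k).
    by rewrite -exprD; congr (_ ^+ _); have := ltn_ord k; lia.
  by rewrite binS bin1 exprD [y ^+ k.+1]exprS; ring.
rewrite big_distrl /= big_ord_recl big_ord_recr /= [qbin t N N.+1]qbin_small //.
rewrite !(mulr0, mul0r) addr0 bin0n qbin0 !subn0 !expr0 !mulr1 mul1r exprSr.
congr (_ + _).
apply: eq_bigr => k _; rewrite /bump leq0n add1n -!mulrA.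
have -> : (N - k = (N - k.+1).+1)%N by have := ltn_ord k; lia.
by rewrite [x ^+ _.+1]exprSr.
Qed.

(** This is [qbinomial] with [x = t ^+ n] and [2 * n] factors. The last [n] factors are
    [t ^+ n * (1 + y * t ^+ i)]; since [t = y * z], the first [n] are
    [y * t ^+ i * (1 + z * t ^+ (n - i.+1))]. No negative powers arise. *)
Lemma finite_triple_product y z t n : y * z = t ->
  \prod_(j < n) ((1 + y * t ^+ j) * (1 + z * t ^+ j))
    * (y ^+ n * t ^+ ('C(n, 2) + n * n)) =
  \sum_(k < (2 * n).+1)
     y ^+ k * t ^+ ('C(k, 2) + n * (2 * n - k)) * qbin t (2 * n) k.
Proof.
move=> yzt; have := qbinomial (t ^+ n) y t (2 * n).
rewrite [X in _ = X -> _](_ : _ = \sum_(k < (2 * n).+1)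
     y ^+ k * t ^+ ('C(k, 2) + n * (2 * n - k)) * qbin t (2 * n) k); last first.
  by apply: eq_bigr => k _; rewrite -exprM exprD; ring.
move=> <-; rewrite mul2n -addnn big_split_ord /= big_split /=.
have -> : \prod_(i < n) (t ^+ n + y * t ^+ (n + i)) =
   t ^+ (n * n) * \prod_(i < n) (1 + y * t ^+ i).
  have -> : t ^+ (n * n) = \prod_(i < n) t ^+ n.
    by rewrite prodr_const card_ord exprM.
  by rewrite -big_split /=; apply: eq_bigr => i _; rewrite exprD; ring.
have -> : \prod_(i < n) (t ^+ n + y * t ^+ i) =
   y ^+ n * t ^+ 'C(n, 2) * \prod_(i < n) (1 + z * t ^+ i).
  have -> : t ^+ 'C(n, 2) = \prod_(i < n) t ^+ i.
    by rewrite -triangular_sum big_mkord expr_sum.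
  rewrite [X in _ = _ * X](reindex_inj rev_ord_inj) /=.
  have -> : y ^+ n = \prod_(i < n) y by rewrite prodr_const card_ord.
  rewrite -!big_split /=.
  apply: eq_bigr => i _.
  have -> : t ^+ n = t ^+ i * (t * t ^+ (n - i.+1)).
    by rewrite -exprS -exprD; congr (_ ^+ _); have := ltn_ord i; lia.
  by rewrite -{2}yzt; ring.
by rewrite exprD; ring.
Qed.

End EqMod.

(** * Multiplication by powers of [q] *)

Lemma fcoefXM k f n :
  fcoef (q ^+ k * f) n = if (n < k)%N then 0 else fcoef f (n - k).
Proof.
have fq m : fcoef q m = (m == 1)%:R by [].
elim: k n => [|k IHk] n; first by rewrite mul1r subn0.
rewrite exprS -mulrA; case: n => [|n]; first by rewrite fcoefM0 fq mul0r.
rewrite fcoefM !big_ord_recl big1 => [|i _]; last by rewrite fq mul0r.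
by rewrite !fq mul0r add0r addr0 mul1r /bump /= subn1 /= IHk.
Qed.

Lemma fcoefXn k n : fcoef (q ^+ k) n = (n == k)%:R.
Proof.
rewrite -[q ^+ k]mulr1 fcoefXM fcoef1; case: ltnP; first by lia.
by move=> lekn; rewrite subn_eq0 eqn_leq lekn andbT.
Qed.

Lemma fcoefXn0 k : (0 < k)%N -> fcoef (q ^+ k) 0 = 0.
Proof. by move=> k0; apply: fcoef_exp_small. Qed.

Lemma eqmodXM N k f g : eqmod N f g -> eqmod (k + N) (q ^+ k * f) (q ^+ k * g).
Proof.
move=> fg n ltn; rewrite !fcoefXM; case: ltnP => // lekn.
by apply: fg; lia.
Qed.

Lemma mulXI k f g : q ^+ k * f = q ^+ k * g -> f = g.
Proof.
move=> fg; apply: fpsP => n; have := congr1 (fun h => fcoef h (n + k)) fg.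
by rewrite !fcoefXM ltnNge leq_addl /= addnK.
Qed.

Lemma qpoch_eqmod1 c t : eqmod c (qpoch (q ^+ c) t) 1.
Proof.
move=> n ltn; rewrite fcoefE.
have : eqmod c (\prod_(j < n.+1) (1 - q ^+ c * t ^+ j)) (\prod_(j < n.+1) 1).
  apply: eqmod_prod => j _ m ltm.
  by rewrite fcoefB fcoefXM ltm subr0.
by rewrite big1_eq => ->.
Qed.

(** * The Jacobi triple product *)

(* The generalised pentagonal number b m (m - 1) / 2 + m; it is a natural
   number when b >= 2, so that the truncated subtraction is exact. *)
Definition theta_exp (b : nat) (m : int) : nat :=
  match m with
  | Posz n => b * 'C(n, 2) + n
  | Negz n => b * 'C(n.+2, 2) - n.+1
  end%N.

Lemma double_bin2 n : (2 * 'C(n.+1, 2) = n.+1 * n)%N.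
Proof. by elim: n => // n IHn; rewrite binS bin1; lia. Qed.

Lemma theta_expE b m : (2 <= b)%N ->
  2 * (theta_exp b m)%:Z = b%:Z * (m * (m - 1)) + 2 * m.
Proof.
move=> b2; case: m => [[|n]|n] /=.
- by rewrite bin0n; lia.
- by have := double_bin2 n; nia.
- have C2 := double_bin2 n.+1; have : (n.+1 <= b * 'C(n.+2, 2))%N by nia.
  by rewrite NegzE; nia.
Qed.

(** This makes theta sums locally finite: degree [n] only involves indices between [-n] and [n]. *)
Lemma theta_exp_ge b m : (2 <= b)%N -> (`|m| <= theta_exp b m)%N.
Proof. by move=> b2; have := theta_expE m b2; nia. Qed.

(** For [t = q ^+ b] and [y] equal to [q] up to sign, the left side is the degree of the [k]-th
    monomial in [finite_triple_product]; on the right, all but [theta_exp] is the degree of the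
    monomial multiplying the product there, which is to be cancelled. *)
Lemma theta_exp_shift b n k : (2 <= b)%N -> (k <= 2 * n)%N ->
  (b * ('C(k, 2) + n * (2 * n - k)) + k =
   n + b * ('C(n, 2) + n * n) + theta_exp b (k%:Z - n%:Z))%N.
Proof.
move=> b2 lek; have := theta_expE (k%:Z - n%:Z) b2.
have C2 j : 2 * 'C(j, 2)%:Z = j%:Z * (j%:Z - 1) :> int.
  by case: j => [|j]; [rewrite bin0n; lia | have := double_bin2 j; lia].
have := C2 k; have := C2 n; set x := 'C(k, 2); set y := 'C(n, 2) => hx hy he.
suff : (2 * (b%:Z * (x%:Z + n%:Z * (2 * n%:Z - k%:Z)) + k%:Z) =
  2 * (n%:Z + b%:Z * (y%:Z + n%:Z * n%:Z))
    + 2 * (theta_exp b (k%:Z - n%:Z))%:Z).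
  by nia.
rewrite he.
have -> : 2 * (b%:Z * (x%:Z + n%:Z * (2 * n%:Z - k%:Z)) + k%:Z) =
  b%:Z * (2 * x%:Z) + 2 * b%:Z * n%:Z * (2 * n%:Z - k%:Z) + 2 * k%:Z by ring.
have -> : 2 * (n%:Z + b%:Z * (y%:Z + n%:Z * n%:Z)) =
  b%:Z * (2 * y%:Z) + 2 * n%:Z + 2 * b%:Z * n%:Z * n%:Z by ring.
by rewrite hx hy; ring.
Qed.

(** The product side of Jacobi's identity for the base [q ^+ b] and two parameters with product
    [q ^+ b]. The parity of [s] decides whether the signs of the sum alternate. *)
Definition theta_prod (b s : nat) : fps int :=
  qpoch (q ^+ b) (q ^+ b) * (qpoch (- ((-1) ^+ s * q)) (q ^+ b)
                             * qpoch (- ((-1) ^+ s * q ^+ b.-1)) (q ^+ b)).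

(** In the factorial formula for [qbin], each [qfact t i] with [i >= j] agrees with the infinite
    product [E] to the stated order. Hence [qbin * E * E] is congruent to [E], and one unit [E]
    cancels. *)
Lemma qbin_eqmod b n k : (0 < b)%N -> (k <= 2 * n)%N ->
  eqmod (b * (minn k (2 * n - k)).+1)
    (qpoch (q ^+ b) (q ^+ b) * qbin (q ^+ b) (2 * n) k) 1.
Proof.
move=> b0 lek; set j := minn _ _; set t := q ^+ b; set E := qpoch t t.
have t0 : fcoef t 0 = 0 by exact: fcoefXn0.
have factE i : (j <= i)%N -> eqmod (b * j.+1) (qfact t i) E.
  move=> leji; rewrite /E (qpoch_shift t i t0) -[X in eqmod _ X _]mulr1.
  apply: eqmodM => //; apply: (@eqmodW _ (b * i.+1)); first by nia.
  by rewrite -exprS -exprM; apply/eqmod_sym/qpoch_eqmod1.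
have EU : E \is a GRing.unit.
  by change (fcoef E 0 \is a GRing.unit); rewrite qpoch_fcoef0 ?unitr1.
have eq1 : eqmod (b * j.+1) (qbin t (2 * n) k * (E * E)) E.
  apply: (eqmod_trans (g := qfact t (2 * n))); last by apply: factE; lia.
  rewrite -(qbin_fact t lek); apply: eqmodM => //.
  by apply: eqmod_sym; apply: eqmodM; apply: factE; lia.
have := eqmodM eq1 (@eqmod_refl _ (b * j.+1)%N E^-1).
by rewrite divrr // [qbin _ _ _ * _]mulrA mulrK // mulrC.
Qed.

(** The finite identity is freed of its common power of [q] and multiplied by [qpoch t t]; then
    [qbin_eqmod] replaces each Gaussian binomial by 1. *)
Lemma triple_product_eqmod b s n : (2 <= b)%N ->
  eqmod n (theta_prod b s)
    (\sum_(k < (2 * n).+1)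
        (-1) ^+ (s * (n + k)) * q ^+ theta_exp b (k%:Z - n%:Z)).
Proof.
move=> b2; rewrite /theta_prod; set t := q ^+ b.
set y := (-1) ^+ s * q; set z := (-1) ^+ s * q ^+ b.-1.
have b0 : (0 < b)%N by lia.
have t0 : fcoef t 0 = 0 by exact: fcoefXn0.
have yzt : y * z = t.
  rewrite mulrACA -expr2 sqrr_sign mul1r -exprS; congr (_ ^+ _); lia.
have fin : \prod_(j < n) ((1 + y * t ^+ j) * (1 + z * t ^+ j)) =
  \sum_(k < (2 * n).+1) (-1) ^+ (s * (n + k)) *
     (q ^+ theta_exp b (k%:Z - n%:Z) * qbin t (2 * n) k).
  apply: (@mulXI (n + b * ('C(n, 2) + n * n))).
  have := finite_triple_product n yzt.
  rewrite [y ^+ n]exprMn -exprM => /(congr1 ( *%R ((-1) ^+ (s * n)))).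
  set P := \prod_(j < n) _ => eqP.
  (* The extra sign cancels the one in [y ^+ n]; on the other side it joins the sign of [y ^+ k] to
     give [(-1) ^+ (s * (n + k))]. *)
  transitivity ((-1) ^+ (s * n) *
    (P * ((-1) ^+ (s * n) * q ^+ n * t ^+ ('C(n, 2) + n * n)))).
    have -> : (-1) ^+ (s * n) * (P * ((-1) ^+ (s * n) * q ^+ n
        * t ^+ ('C(n, 2) + n * n))) = ((-1) ^+ (s * n)) ^+ 2 * (q ^+ n
        * t ^+ ('C(n, 2) + n * n) * P) by ring.
    by rewrite sqrr_sign mul1r exprD exprM.
  rewrite eqP !mulr_sumr; apply: eq_bigr => k _.
  have lek : (k <= 2 * n)%N by rewrite -ltnS.
  rewrite [RHS]mulrCA [X in _ = _ * X]mulrA -exprD -(theta_exp_shift b2 lek).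
  rewrite [q ^+ (_ + k)]exprD [q ^+ (b * _)]exprM mulnDr [(-1) ^+ (_ + _)]exprD.
  by rewrite [y ^+ k]exprMn -[(-1) ^+ s ^+ k]exprM; ring.
apply: (@eqmod_trans _ _ (qpoch t t *
  \prod_(j < n) ((1 + y * t ^+ j) * (1 + z * t ^+ j)))).
  apply: eqmodM => //; rewrite big_split /=.
  by apply: eqmodM; apply/eqmod_sym/qpochN_eqmod.
rewrite fin mulr_sumr; apply: eqmod_sum => k _.
rewrite mulrCA; apply: eqmodM => //.
have lek : (k <= 2 * n)%N by rewrite -ltnS.
have := @eqmodXM _ (theta_exp b (k%:Z - n%:Z)) _ _ (qbin_eqmod b0 lek).
rewrite mulr1 mulrCA; apply: eqmodW.
(* The error has order at least [e + b * (n - |k - n| + 1)], which exceeds [n] because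
   [e >= |k - n|]. *)
have := theta_expE (k%:Z - n%:Z) b2; set e := theta_exp _ _ => he.
have [d hd] : {d : int | k%:Z - n%:Z = d} by eexists.
rewrite hd in he.
by have [lekn|ltnk] := leqP k n; nia.
Qed.

(** Encodes the expansion of [T] as the sum of [(-1)^(s m) q^(e m)] over all integers [m]. Any
    duplicate-free list covering the fibre of [e] over [n] may be used, which makes reindexing
    easy. *)
Definition is_theta (e : int -> nat) (s : nat) (T : fps int) :=
  forall n (r : seq int), uniq r -> (forall m, e m = n -> m \in r) ->
    fcoef T n = \sum_(m <- r | e m == n) (-1) ^+ (s * `|m|%N).

(** By [theta_exp_ge] the window from [-N] to [N] of the approximation already contains the fibre
    over [n]; filtered to that fibre, it is a permutation of any other covering list. *)
Lemma triple_product b s : (2 <= b)%N ->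
  is_theta (theta_exp b) s (theta_prod b s).
Proof.
move=> b2 n r Ur cov; rewrite (triple_product_eqmod s b2 (leqnn n.+1)).
set N := n.+1; pose w : seq int := [seq k%:Z - N%:Z | k <- iota 0 (2 * N).+1].
transitivity (\sum_(m <- w | theta_exp b m == n) (-1) ^+ (s * `|m|%N) : int).
  rewrite fcoef_sum big_map -[iota _ _]/(index_iota 0 (2 * N).+1) big_mkord.
  rewrite [RHS]big_mkcond /=; apply: eq_bigr => k _.
  rewrite fcoef_sign fcoefXn eq_sym; case: eqP => _; rewrite ?mulr0 // mulr1.
  rewrite -signr_odd -[RHS]signr_odd !oddM; congr (_ ^+ (_ && _)); lia.
rewrite -big_filter -[RHS]big_filter; apply/perm_big/uniq_perm.
- by apply/filter_uniq; rewrite map_inj_uniq ?iota_uniq // => i j; lia.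
- exact: filter_uniq.
move=> m; rewrite !mem_filter; case: eqP => //= em.
rewrite cov //; apply/mapP; exists `|(m + N%:Z)%R|%N.
  by rewrite mem_iota; have := theta_exp_ge m b2; lia.
by have := theta_exp_ge m b2; lia.
Qed.

(** * Dilation and dissection of power series *)

(** The substitution of [q ^+ p] for [q]. *)
Definition fps_dil (R : comNzRingType) (p : nat) (f : fps R) : fps R :=
  Fps (fun n => if (p %| n)%N then fcoef f (n %/ p)%N else 0).

(** The retained terms keep their degrees, so that dilated series act as scalars, as [fps_sectM]
    shows. *)
Definition fps_sect (R : comNzRingType) (p r : nat) (f : fps R) : fps R :=
  Fps (fun n => if n == r %[mod p] then fcoef f n else 0).

Section Dilation.
Context {R : comNzRingType} (p : nat) (p_gt0 : (0 < p)%N).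
Implicit Types f g : fps R.

Lemma fcoef_dil f n :
  fcoef (fps_dil p f) n = if (p %| n)%N then fcoef f (n %/ p)%N else 0.
Proof. by []. Qed.

Lemma fcoef_sect r f n :
  fcoef (fps_sect p r f) n = if n == r %[mod p] then fcoef f n else 0.
Proof. by []. Qed.

Lemma fcoef_dilM f n : fcoef (fps_dil p f) (p * n) = fcoef f n.
Proof. by rewrite fcoef_dil dvdn_mulr // mulKn. Qed.

Lemma fps_dil1 : fps_dil p 1 = 1 :> fps R.
Proof.
apply: fpsP => n; rewrite fcoef_dil !fcoef1.
case: ifP => [/dvdnP[m ->]|]; first by
  rewrite mulnK // muln_eq0 [p == 0]eqn0Ngt p_gt0 orbF.
by case: n => //; rewrite dvdn0.
Qed.

Lemma fps_dilB f g : fps_dil p (f - g) = fps_dil p f - fps_dil p g.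
Proof.
apply: fpsP => n; rewrite fcoefB !fcoef_dil fcoefB.
by case: ifP; rewrite ?subr0.
Qed.

Lemma fps_dilM f g : fps_dil p (f * g) = fps_dil p f * fps_dil p g.
Proof.
apply: fpsP => n; rewrite fcoef_dil fcoefM.
case: ifP => [/dvdnP[m ->]|ndvd]; last first.
  rewrite fcoefM big1 // => i _; rewrite !fcoef_dil.
  case: ifP => [dvdi|]; last by rewrite mul0r.
  case: ifP => [dvdni|]; last by rewrite mulr0.
  have := dvdn_add dvdi dvdni; rewrite subnKC ?ndvd //.
  by rewrite -ltnS.
rewrite mulnK // fcoefM mulnC.
rewrite [RHS](bigID (fun i : 'I_(p * m).+1 => p %| i)%N) /= addrC.
rewrite [X in _ = X + _]big1 ?add0r.
  rewrite [RHS](reindex_onto (fun j : 'I_m.+1 => inord (p * j) : 'I_(p * m).+1)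
     (fun i => inord (i %/ p))) /=.
    apply: eq_big => [j|j _].
      have ltj := ltn_ord j.
      rewrite inordK; last by rewrite ltnS leq_mul2l; lia.
      by rewrite dvdn_mulr // mulKn // inord_val eqxx.
    have ltj := ltn_ord j; rewrite inordK; last by rewrite ltnS leq_mul2l; lia.
    by rewrite -mulnBr !fcoef_dilM.
  move=> i dvdi; apply: val_inj.
  have ltm : (i %/ p < m.+1)%N.
    by have := ltn_ord i; rewrite !ltnS leq_divLR // [(m * p)%N]mulnC.
  by rewrite /= inordK inordK // mulnC divnK.
by move=> i /negbTE ndvd; rewrite fcoef_dil ndvd mul0r.
Qed.

Lemma fps_dil_prod (I : Type) (r : seq I) (P : pred I) (F : I -> fps R) :
  fps_dil p (\prod_(i <- r | P i) F i) = \prod_(i <- r | P i) fps_dil p (F i).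
Proof. exact: (big_morph _ fps_dilM fps_dil1). Qed.

Lemma fps_dilX f k : fps_dil p (f ^+ k) = fps_dil p f ^+ k.
Proof.
by elim: k => [|k IHk]; rewrite ?expr0 ?fps_dil1 // !exprS fps_dilM IHk.
Qed.

Lemma fps_dil_qpoch a t : fcoef t 0 = 0 ->
  fps_dil p (qpoch a t) = qpoch (fps_dil p a) (fps_dil p t) :> fps R.
Proof.
move=> t0; apply: fpsP => n.
(* Since [n %/ p <= n], one partial product with [n.+1] factors serves both sides. *)
transitivity (fcoef (fps_dil p (\prod_(j < n.+1) (1 - a * t ^+ j))) n).
  rewrite !fcoef_dil; case: ifP => // _.
  by rewrite (@qpoch_cvg _ a t (n %/ p) n.+1) // ltnS leq_div.
rewrite fps_dil_prod fcoefE; congr (fcoef _ n); apply: eq_bigr => j _.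
by rewrite fps_dilB fps_dil1 fps_dilM fps_dilX.
Qed.

(** A dilated factor only has degrees divisible by [p], hence does not move terms between residue
    classes. *)
Lemma fps_sectM r f g :
  fps_sect p r (f * fps_dil p g) = fps_sect p r f * fps_dil p g.
Proof.
apply: fpsP => n; rewrite fcoef_sect !fcoefM.
transitivity (\sum_(i < n.+1) (if n == r %[mod p]
    then fcoef f i * fcoef (fps_dil p g) (n - i) else 0)).
  by case: ifP => // _; rewrite big1_eq.
apply: eq_bigr => i _; rewrite fcoef_sect fcoef_dil.
case: (boolP (p %| n - i)%N) => [dvd|_]; last by rewrite !mulr0 if_same.
have lei : (i <= n)%N by rewrite -ltnS.
have -> : (n == r %[mod p]) = (i == r %[mod p]).
  by move: dvd; rewrite -eqn_mod_dvd // => /eqP ->.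
by case: ifP; rewrite ?mul0r.
Qed.

End Dilation.

Lemma fps_dilV (R : comUnitRingType) p (f : fps R) : (0 < p)%N ->
  f \is a GRing.unit -> fps_dil p f^-1 = (fps_dil p f)^-1.
Proof.
move=> p0 fU; have VU : fps_dil p f^-1 * fps_dil p f = 1.
  by rewrite -fps_dilM // mulVr // fps_dil1.
have fVU : fps_dil p f \is a GRing.unit.
  by apply/unitrPr; exists (fps_dil p f^-1); rewrite mulrC.
by rewrite -[LHS](mulrK fVU) VU mul1r.
Qed.

Lemma fps_dil_Xn p k : (0 < p)%N -> fps_dil p (q ^+ k) = q ^+ (p * k).
Proof.
move=> p0; apply: fpsP => n; rewrite fcoef_dil !fcoefXn.
case: ifP => [/dvdnP[m ->]|ndvd]; first by rewrite mulnK // mulnC eqn_pmul2l.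
by case: eqP => // en; rewrite en dvdn_mulr in ndvd.
Qed.

(** The map [phi] parametrises the indices whose exponent is [r] modulo [p]; reindexing along it
    multiplies exponents by [p] twice, adds [r], and changes all signs by the same factor. *)
Lemma theta_sect (e : int -> nat) s T p r c (phi : int -> int) :
  (0 < p)%N -> is_theta e s T -> (forall m, `|m| <= e m)%N ->
  injective phi -> (forall m, e (phi m) = p * (p * e m) + r)%N ->
  (forall m, e m = r %[mod p] -> exists m', m = phi m') ->
  (forall m, odd (s * `|phi m|) = odd (c + s * `|m|)) ->
  fps_sect p r T = (-1) ^+ c * (q ^+ r * fps_dil p (fps_dil p T)).
Proof.
move=> p0 thT e_ge phiI e_phi phi_onto sgn_phi.
apply: fpsP => n; rewrite fcoef_sect fcoef_sign fcoefXM !fcoef_dil.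
case: eqP => [nr|nr]; last first.
  case: ltnP => [_|lern]; rewrite ?mulr0 //.
  case: ifP => [|_]; rewrite ?mulr0 // -eqn_mod_dvd // => /eqP nr'.
  by case: nr.
(* One window for both uses of [thT]: its image under [phi] covers the fibre over [n], and [w]
   itself covers the fibre over the quotient of [n - r] by the square of [p]. *)
pose w : seq int := [seq k%:Z - n%:Z | k <- iota 0 (2 * n).+1].
have Uw : uniq w by rewrite map_inj_uniq ?iota_uniq // => i j; lia.
have mw m : (e m <= n)%N -> m \in w.
  move=> lem; apply/mapP; exists `|(m + n%:Z)%R|%N.
    by rewrite mem_iota; have := e_ge m; lia.
  by have := e_ge m; lia.
have le_pp k : (k <= p * (p * k))%N by rewrite mulnA leq_pmull // muln_gt0 p0.
have -> : fcoef T n = \sum_(m <- map phi w | e m == n) (-1) ^+ (s * `|m|%N).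
  apply: thT; first by rewrite map_inj_uniq.
  move=> m em; have [m' em'] := phi_onto m (etrans (congr1 (modn^~ p) em) nr).
  move: em; rewrite em' e_phi => en; apply/map_f/mw.
  by rewrite -en (leq_trans (le_pp _)) ?leq_addr.
rewrite big_map.
have -> : \sum_(m <- w | e (phi m) == n) (-1) ^+ (s * `|phi m|%N) =
  (-1) ^+ c * \sum_(m <- w | (p * (p * e m) + r == n)%N)
    (-1) ^+ (s * `|m|%N) :> int.
  rewrite mulr_sumr; apply: eq_big => [m|m _]; first by rewrite e_phi.
  by rewrite -exprD -signr_odd sgn_phi signr_odd.
congr (_ * _); case: ltnP => [ltnr|lern].
  by rewrite big_pred0 // => m; apply/eqP; lia.
have -> : n = (n - r + r)%N by rewrite subnK.
rewrite addnK; under eq_bigl do rewrite eqn_add2r.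
case: ifP => [/dvdnP[u eu]|ndvd]; last first.
  by rewrite big_pred0 // => m; apply/eqP => en; rewrite -en dvdn_mulr in ndvd.
rewrite eu mulnK //; under eq_bigl do rewrite [(u * p)%N]mulnC eqn_pmul2l //.
case: ifP => [/dvdnP[v ev]|ndvd]; last first.
  by rewrite big_pred0 // => m; apply/eqP => en; rewrite -en dvdn_mulr in ndvd.
rewrite ev mulnK //; under eq_bigl do rewrite [(v * p)%N]mulnC eqn_pmul2l //.
apply/esym/thT => // m em; apply: mw; rewrite em.
apply: leq_trans (le_pp v) _.
by rewrite [(p * v)%N]mulnC -ev mulnC -eu leq_subr.
Qed.

Lemma theta_quotient p r c (T : fps int) n : (0 < p)%N ->
  T \is a GRing.unit ->
  fps_sect p r T = (-1) ^+ c * (q ^+ r * fps_dil p (fps_dil p T)) ->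
  fcoef (T / fps_dil p T) (p * n + r) =
  (-1) ^+ c * fcoef (T / fps_dil p T)^-1 n.
Proof.
move=> p0 TU sT; rewrite -fps_dilV //.
have -> : fcoef (T * fps_dil p T^-1) (p * n + r) =
          fcoef (fps_sect p r (T * fps_dil p T^-1)) (p * n + r).
  by rewrite fcoef_sect mulnC modnMDl eqxx.
(* Apart from sign and [q ^+ r], what remains is the dilation of [fps_dil p T / T], the required
   reciprocal. *)
rewrite fps_sectM // sT -!mulrA -fps_dilM // fcoef_sign fcoefXM.
rewrite ltnNge leq_addl /= addnK fcoef_dilM // fps_dilV // invrM ?invrK //.
by rewrite unitrV; apply/unitrPr; exists (fps_dil p T^-1);
  rewrite -fps_dilM // divrr // fps_dil1.
Qed.

(* Completing the square, A e(m) + 1 = (D m - 1)^2, so that e(m) = r modulo p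
   amounts to p dividing D m - 1. *)
Section Square.
Variables (e : int -> nat) (A D p r c : nat) (d : int).
Hypotheses (p_prime : prime p) (A_gt0 : (0 < A)%N) (d_sq : d * d = 1).
Hypotheses (pE : p%:Z = D%:Z * c%:Z + d) (rE : A%:Z * r%:Z + 1 = p%:Z * p%:Z).
Hypothesis eE : forall m, A%:Z * (e m)%:Z + 1 = (D%:Z * m - 1) ^+ 2.

(** Chosen so that [D * phi m - 1 = d * p * (D * m - 1)], as follows from [p = D * c + d] and
    [d * d = 1]. *)
Let phi (m : int) := d * (p%:Z * m - c%:Z).

Lemma square_phi_inj : injective phi.
Proof.
move=> m m' /(congr1 ( *%R d)); rewrite /phi !mulrA d_sq !mul1r => eq.
by apply: mulfI (addIr _ eq); rewrite eqz_nat -lt0n prime_gt0.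
Qed.

(** Squaring [D * phi m - 1 = d * p * (D * m - 1)] gives [A * e (phi m) + 1 = p^2 * (A * e m + 1)],
    and [p^2 = A * r + 1]. *)
Lemma square_phi_exp m : (e (phi m) = p * (p * e m) + r)%N.
Proof.
have h : A%:Z * (e (phi m))%:Z = A%:Z * (p%:Z * (p%:Z * (e m)%:Z) + r%:Z).
  have -> : A%:Z * (p%:Z * (p%:Z * (e m)%:Z) + r%:Z) =
    p%:Z * p%:Z * (A%:Z * (e m)%:Z + 1) - p%:Z * p%:Z + A%:Z * r%:Z by ring.
  have -> : A%:Z * (e (phi m))%:Z = (A%:Z * (e (phi m))%:Z + 1) - 1 by ring.
  have -> : A%:Z * r%:Z = p%:Z * p%:Z - 1 by rewrite -rE; ring.
  rewrite !eE /phi.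
  have -> : (D%:Z * (d * (p%:Z * m - c%:Z)) - 1) =
     d * p%:Z * (D%:Z * m) - d * (D%:Z * c%:Z + d) + (d * d - 1) by ring.
  rewrite -pE d_sq subrr addr0.
  transitivity (d * d * (p%:Z * p%:Z * (D%:Z * m - 1) ^+ 2) - 1); first by ring.
  by rewrite d_sq; ring.
have A0 : A%:Z != 0 by rewrite eqz_nat -lt0n.
by have := mulfI A0 h; rewrite -!PoszM -PoszD => -[].
Qed.

Lemma square_phi_onto m : e m = r %[mod p] -> exists m', m = phi m'.
Proof.
move=> emr; have e1 := divn_eq (e m) p; have e2 := divn_eq r p.
set x := D%:Z * m - 1.
have : (p%:Z %| x ^+ 2)%Z.
  apply/dvdzP; exists (A%:Z * ((e m %/ p)%N%:Z - (r %/ p)%N%:Z) + p%:Z).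
  have er : (e m)%:Z - r%:Z = ((e m %/ p)%N%:Z - (r %/ p)%N%:Z) * p%:Z.
    by rewrite {1}e1 {1}e2 emr !PoszD !PoszM; ring.
  have -> : x ^+ 2 = A%:Z * ((e m)%:Z - r%:Z) + (A%:Z * r%:Z + 1).
    by rewrite -eE; ring.
  by rewrite rE er; ring.
rewrite dvdzE /= abszX Euclid_dvdX // => /andP[pdx _].
have /dvdzP[l xl] : (p%:Z %| x)%Z by rewrite dvdzE.
(* From [D * m = l * p + 1] one gets [p * (m - c * l) - c = p * m - c * D * m = d * m]. *)
exists (m - c%:Z * l); rewrite /phi.
have Dm : D%:Z * m = l * p%:Z + 1 by rewrite -xl /x; ring.
have -> : d * (p%:Z * (m - c%:Z * l) - c%:Z) =
  d * (p%:Z * m - c%:Z * (l * p%:Z + 1)) by ring.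
rewrite -Dm [in p%:Z * m]pE.
have -> : d * ((D%:Z * c%:Z + d) * m - c%:Z * (D%:Z * m)) = d * d * m by ring.
by rewrite d_sq mul1r.
Qed.

End Square.

(** * The theta functions as eta quotients *)

Definition euler k : fps int := qpoch (q ^+ k) (q ^+ k).

Lemma euler_unit k : (0 < k)%N -> euler k \is a GRing.unit.
Proof.
move=> k0; change (fcoef (euler k) 0 \is a GRing.unit).
by rewrite qpoch_fcoef0 ?unitr1 // fcoefXn0.
Qed.

Lemma euler_dil p k : (0 < p)%N -> (0 < k)%N ->
  fps_dil p (euler k) = euler (p * k).
Proof.
move=> p0 k0; rewrite /euler (fps_dil_qpoch p0 _ (fcoefXn0 k0)).
by rewrite (fps_dil_Xn _ p0).
Qed.

(** This is [qpoch_split] with [a = t = q ^+ c]; the last residue class is [euler (c * p)]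
    itself. *)
Lemma euler_split c p : (0 < p)%N -> (0 < c)%N ->
  \prod_(i <- iota 1 p.-1) qpoch (q ^+ (c * i)) (q ^+ (c * p)) * euler (c * p)
    = euler c.
Proof.
move=> p0 c0; rewrite [RHS]/euler -(qpoch_split (q ^+ c) p0 (fcoefXn0 c0)).
case: p p0 => // p _; rewrite big_ord_recr /= -exprS -!exprM.
congr (_ * _).
have -> : iota 1 p = index_iota 1 p.+1 by rewrite /index_iota subn1.
rewrite big_add1 big_mkord.
by apply: eq_bigr => i _; rewrite -exprS -exprM.
Qed.

Lemma P1_euler p : (0 < p)%N -> P1 p = euler 1 / euler p.
Proof.
move=> p0; have := euler_split p0 (ltnSn 0); rewrite mul1n => <-.
rewrite mulrK ?euler_unit // /P1 /qpochs big_map.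
by apply: eq_bigr => i _; rewrite mul1n.
Qed.

Lemma P2_euler p : (0 < p)%N -> P2 p = euler 2 / euler (2 * p).
Proof.
move=> p0; rewrite -(euler_split p0 (isT : 0 < 2)%N).
by rewrite mulrK ?euler_unit ?muln_gt0 // /P2 /qpochs big_map.
Qed.

(** The product side of Euler's pentagonal number theorem: the three factors are the residue classes
    modulo 3. *)
Lemma theta_prod_pentagonal : theta_prod 3 1 = euler 1.
Proof.
rewrite -(@euler_split 1 3) // /theta_prod !big_cons big_nil !mul1n.
by rewrite !expr1 !mulN1r !opprK /euler; ring.
Qed.

(** Gauss's theta function [phi(-q)]; here both parameters equal [-q]. *)
Lemma theta_prod_phi : theta_prod 2 1 = euler 1 ^+ 2 / euler 2.
Proof.
have U := euler_unit (isT : 0 < 2)%N.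
apply: (mulIr U); rewrite (divrK U).
rewrite -(@euler_split 1 2) // /theta_prod !big_cons big_nil !mul1n.
by rewrite !expr1 !mulN1r !opprK /euler; ring.
Qed.

(** Gauss's theta function [psi(q)]; [qpoch_sqr] removes the factors with plus signs. *)
Lemma theta_prod_psi : theta_prod 4 0 = euler 2 ^+ 2 / euler 1.
Proof.
have U := euler_unit (isT : 0 < 1)%N; apply: (mulIr U); rewrite (divrK U).
have t0 : fcoef (q ^+ 4) 0 = 0 by exact: fcoefXn0.
have s1 := qpoch_sqr (q ^+ 1) t0; have s3 := qpoch_sqr (q ^+ 3) t0.
rewrite -[(_ ^+ 1) ^+ 2]exprM -exprM in s1.
rewrite -[(_ ^+ 3) ^+ 2]exprM -exprM in s3.
have e1 := @euler_split 1 4 isT isT; have e2 := @euler_split 2 2 isT isT.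
have e24 := @euler_split 2 4 isT isT; have e4 := @euler_split 4 2 isT isT.
rewrite !big_cons !big_nil mulr1 !mul1n in e1.
rewrite !big_cons !big_nil mulr1 in e2.
rewrite !big_cons !big_nil mulr1 in e24.
rewrite !big_cons !big_nil mulr1 in e4.
rewrite /theta_prod mul1r [(-1) ^+ 0 * _]mul1r.
(* Here [ai], [bi], [ci] stand for [(q^i; q^4)], [(q^i; q^8)], [(-q^i; q^4)] and [Ek] for
   [euler k]. *)
have alg (a1 a2 a3 b2 b4 b6 c1 c3 E1 E2 E4 E8 : fps int) :
    c1 * a1 = b2 -> c3 * a3 = b6 -> a1 * (a2 * a3) * E4 = E1 ->
    a2 * E4 = E2 -> b2 * (b4 * b6) * E8 = E2 -> b4 * E8 = E4 ->
    E4 * (c1 * c3) * E1 = E2 ^+ 2.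
  by move=> <- <- <- h2 h24 h4; rewrite expr2 -{1}h2 -h24 -{1}h4; ring.
exact: alg s1 s3 e1 e2 e24 e4.
Qed.

(** * Theta functions along an arithmetic progression *)

Lemma theta_exp_square3 m :
  24%N%:Z * (theta_exp 3 m)%:Z + 1 = (6%N%:Z * m - 1) ^+ 2.
Proof.
have e2 := theta_expE m (isT : 2 <= 3)%N.
have -> : 24%N%:Z * (theta_exp 3 m)%:Z = 12 * (2 * (theta_exp 3 m)%:Z) by ring.
by rewrite e2; ring.
Qed.

Lemma theta_exp_square4 m :
  8%N%:Z * (theta_exp 4 m)%:Z + 1 = (4%N%:Z * m - 1) ^+ 2.
Proof.
have e2 := theta_expE m (isT : 2 <= 4)%N.
have -> : 8%N%:Z * (theta_exp 4 m)%:Z = 4 * (2 * (theta_exp 4 m)%:Z) by ring.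
by rewrite e2; ring.
Qed.

Lemma theta_exp2 m : (theta_exp 2 m = `|m| * `|m|)%N.
Proof. by have := theta_expE m (isT : 2 <= 2)%N; nia. Qed.

(** Regroups the eta quotients of [Gamma2] and [Gamma3] into the form [T(q) / T(q^p)]. *)
Lemma sqr_div_swap (R : comUnitRingType) (a b c d : R) :
  b \is a GRing.unit -> c \is a GRing.unit -> d \is a GRing.unit ->
  (a / b) ^+ 2 / (c / d) = a ^+ 2 / c / (b ^+ 2 / d).
Proof.
move=> bU cU dU; rewrite !invrM ?unitrV ?unitrX // !invrK.
by move: b^-1 c^-1 => x y; ring.
Qed.

Lemma fps_dil_sqr_div p (f g : fps int) : (0 < p)%N -> g \is a GRing.unit ->
  fps_dil p (f ^+ 2 / g) = fps_dil p f ^+ 2 / fps_dil p g.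
Proof. by move=> p0 gU; rewrite fps_dilM // fps_dilX // fps_dilV. Qed.

Section Main.
Variables (p : nat) (p_prime : prime p) (p_odd : odd p).

Let p_gt0 : (0 < p)%N. Proof. exact: prime_gt0. Qed.

Lemma sect_pentagonal : (3 < p)%N ->
  fps_sect p ((p ^ 2 - 1) %/ 24) (euler 1) = (-1) ^+ eps p
    * (q ^+ ((p ^ 2 - 1) %/ 24) * fps_dil p (fps_dil p (euler 1))).
Proof.
move=> p_gt3; set r := (_ %/ 24)%N.
have p3 : (p %% 3 != 0)%N.
  apply: contraTneq p_gt3 => p30.
  have := dvdn_prime2 (isT : prime 3) p_prime.
  by rewrite /dvdn p30 => /esym/eqP <-.
(* Since [p] is prime to 12, these are the only residues; their squares are 1 modulo 24, so the
   division by 24 is exact. *)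
have [k [j [pkj j12]]] :
    exists k j, p = (12 * k + j)%N /\ j \in [:: 1; 5; 7; 11]%N.
  exists (p %/ 12)%N, (p %% 12)%N; split; first by lia.
  by rewrite !inE; lia.
have p2 : (p ^ 2 = 24 * (6 * (k * k) + j * k) + j * j)%N by rewrite pkj; ring.
have rE : 24%N%:Z * r%:Z + 1 = p%:Z * p%:Z.
  suff : (24 * r + 1 = p * p)%N by lia.
  by rewrite /r mulnn p2; move: j12; rewrite !inE; lia.
(* The sign for which [p - d] is divisible by 6, with quotient [eps p]. *)
pose d : int := if (p %% 6 == 5)%N then -1 else 1.
have pE : p%:Z = 6%N%:Z * (eps p)%:Z + d by rewrite /eps /d; case: ifP; lia.
have d2 : d * d = 1 by rewrite /d; case: ifP.
rewrite -theta_prod_pentagonal.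
apply: (theta_sect (phi := fun m => d * (p%:Z * m - (eps p)%:Z)) p_gt0
  (triple_product 1 (isT : 2 <= 3)%N)).
- by move=> m; apply: theta_exp_ge.
- exact: square_phi_inj p_prime d2.
- exact: square_phi_exp d2 pE rE theta_exp_square3.
- by move=> m; apply: square_phi_onto p_prime d2 pE rE theta_exp_square3 _.
(* As [d] and [p] are odd, [phi m] has the parity of [m + eps p]; this is the source of the sign in
   the theorem. *)
- move=> m; rewrite !mul1n abszM oddM.
  have -> : odd `|d|%N by rewrite /d; case: ifP.
  have -> : p%:Z * m = 2 * (p./2%:Z * m) + m.
    have : p%:Z = 2 * p./2%:Z + 1 by lia.
    by move=> {1}->; ring.
  by rewrite /=; lia.
Qed.

(** The exponents are squares, so those divisible by [p] come from the multiples [p * m], whose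
    parity is that of [m] because [p] is odd. *)
Lemma sect_phi :
  fps_sect p 0 (euler 1 ^+ 2 / euler 2) = (-1) ^+ 0
    * (q ^+ 0 * fps_dil p (fps_dil p (euler 1 ^+ 2 / euler 2))).
Proof.
rewrite -theta_prod_phi.
apply: (theta_sect (phi := fun m => p%:Z * m) p_gt0
  (triple_product 1 (isT : 2 <= 2)%N)).
- by move=> m; apply: theta_exp_ge.
- by apply: mulfI; lia.
- by move=> m; rewrite !theta_exp2 abszM; lia.
- move=> m; rewrite theta_exp2 mod0n => /eqP; rewrite -/(dvdn p _) mulnn.
  rewrite Euclid_dvdX // andbT => pm.
  have /dvdzP[l ->] : (p%:Z %| m)%Z by rewrite dvdzE.
  by exists l; rewrite mulrC.
- by move=> m; rewrite !mul1n abszM oddM p_odd.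
Qed.

Lemma sect_psi :
  fps_sect p ((p ^ 2 - 1) %/ 8) (euler 2 ^+ 2 / euler 1) = (-1) ^+ 0
    * (q ^+ ((p ^ 2 - 1) %/ 8)
       * fps_dil p (fps_dil p (euler 2 ^+ 2 / euler 1))).
Proof.
set r := (_ %/ 8)%N.
have [k [j [pkj j4]]] : exists k j, p = (4 * k + j)%N /\ j \in [:: 1; 3]%N.
  exists (p %/ 4)%N, (p %% 4)%N; split; first by lia.
  by rewrite !inE; lia.
have p2 : (p ^ 2 = 8 * (2 * (k * k) + j * k) + j * j)%N by rewrite pkj; ring.
have rE : 8%N%:Z * r%:Z + 1 = p%:Z * p%:Z.
  suff : (8 * r + 1 = p * p)%N by lia.
  by rewrite /r mulnn p2; move: j4; rewrite !inE; lia.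
(* The sign for which [p - d] is divisible by 4, with quotient [c]. *)
pose d : int := if (j == 3)%N then -1 else 1.
pose c := (if j == 3 then k.+1 else k)%N.
have pE : p%:Z = 4%N%:Z * c%:Z + d.
  by move: j4; rewrite /c /d pkj !inE; case: ifP; lia.
have d2 : d * d = 1 by rewrite /d; case: ifP.
rewrite -theta_prod_psi.
apply: (theta_sect (phi := fun m => d * (p%:Z * m - c%:Z)) p_gt0
  (triple_product 0 (isT : 2 <= 4)%N)).
- by move=> m; apply: theta_exp_ge.
- exact: square_phi_inj p_prime d2.
- exact: square_phi_exp d2 pE rE theta_exp_square4.
- by move=> m; apply: square_phi_onto p_prime d2 pE rE theta_exp_square4 _.
- by [].
Qed.

(** * The three series as quotients [T(q) / T(q^p)] *)

Lemma Gamma1E : Gamma1 p = euler 1 / fps_dil p (euler 1).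
Proof.
by rewrite /Gamma1 (P1_euler p_gt0) (euler_dil p_gt0 (ltn0Sn 0)) muln1.
Qed.

Lemma Gamma2E : Gamma2 p =
  euler 1 ^+ 2 / euler 2 / fps_dil p (euler 1 ^+ 2 / euler 2).
Proof.
have p2 : (0 < 2 * p)%N by rewrite muln_gt0.
have U2 := euler_unit (isT : 0 < 2)%N.
rewrite (fps_dil_sqr_div _ p_gt0 U2) (euler_dil p_gt0 (isT : 0 < 1)%N).
rewrite (euler_dil p_gt0 (isT : 0 < 2)%N) muln1 [(p * 2)%N]mulnC.
rewrite /Gamma2 (P1_euler p_gt0) (P2_euler p_gt0).
exact: sqr_div_swap (euler_unit p_gt0) U2 (euler_unit p2).
Qed.

Lemma Gamma3E : Gamma3 p =
  euler 2 ^+ 2 / euler 1 / fps_dil p (euler 2 ^+ 2 / euler 1).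
Proof.
have p2 : (0 < 2 * p)%N by rewrite muln_gt0.
have U1 := euler_unit (isT : 0 < 1)%N.
rewrite (fps_dil_sqr_div _ p_gt0 U1) (euler_dil p_gt0 (isT : 0 < 2)%N).
rewrite (euler_dil p_gt0 (isT : 0 < 1)%N) muln1 [(p * 2)%N]mulnC.
rewrite /Gamma3 (P1_euler p_gt0) (P2_euler p_gt0).
exact: sqr_div_swap (euler_unit p2) U1 (euler_unit p_gt0).
Qed.

End Main.

Theorem theorem1p1 (p : nat) (p_prime : prime p) (p_odd : odd p) (n : nat) :
  [/\ (3 < p)%N ->
        gamma1 p (p * n + (p ^ 2 - 1) %/ 24)%N
          = ((-1) ^+ eps p * gamma1' p n)%R,
      gamma2 p (p * n)%N = gamma2' p n
    & gamma3 p (p * n + (p ^ 2 - 1) %/ 8)%N = gamma3' p n].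
Proof.
have p0 := prime_gt0 p_prime.
have U1 := euler_unit (isT : 0 < 1)%N; have U2 := euler_unit (isT : 0 < 2)%N.
have U12 : euler 1 ^+ 2 / euler 2 \is a GRing.unit.
  by rewrite unitrM unitrV (unitrX _ U1) U2.
have U21 : euler 2 ^+ 2 / euler 1 \is a GRing.unit.
  by rewrite unitrM unitrV (unitrX _ U2) U1.
split=> [p3||].
- rewrite /gamma1 /gamma1' (Gamma1E p_prime).
  exact: theta_quotient p0 U1 (sect_pentagonal p_prime p_odd p3).
- rewrite /gamma2 /gamma2' (Gamma2E p_prime).
  have := theta_quotient n p0 U12 (sect_phi p_prime p_odd).
  by rewrite addn0 mul1r.
- rewrite /gamma3 /gamma3' (Gamma3E p_prime).
  by have := theta_quotient n p0 U21 (sect_psi p_prime p_odd); rewrite mul1r.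
Qed.
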